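(* Let $G$ be a finite simple graph with no connected component isomorphic to $K_2$. If $\delta(G)\ge 8\chi(G)$, where $\delta(G)$ is the minimum degree and $\chi(G)$ the chromatic number of $G$, then $G$ admits a vertex-coloring $2$-edge-weighting.
   Context: A $k$-edge-weighting of $G$ is a map $w:E(G)\to\{1,\dots,k\}$; it induces the vertex coloring $c(u)=\sum_{e\ni u} w(e)$ for $u\in V(G)$. The edge-weighting is vertex-coloring if $c(u)\ne c(v)$ for every edge $uv\in E(G)$. *)

(* Defs.v *)
From mathcomp Require Import all_boot.
Set Implicit Arguments.
Unset Strict Implicit.
Unset Printing Implicit Defensive.

Record sgraph := SGraph {
  vertex :> finType;
  adj : rel vertex;
  adj_sym : symmetric adj;
  adj_irrefl : irreflexive adj }.

Definition edges (G : sgraph) : {set {set G}} :=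
  [set [set p.1; p.2] | p in [set p : G * G | adj p.1 p.2]].

Definition degree (G : sgraph) (u : G) : nat := #|[set v | adj u v]|.

(* Every degree is smaller than #|G|, so the seed #|G| is irrelevant unless G  *)
(* has no vertex, in which case the value is 0.                                *)
Definition min_degree (G : sgraph) : nat := \big[minn/#|G|]_(u : G) degree u.

Definition proper_coloring (G : sgraph) (C : eqType) (f : G -> C) : bool :=
  [forall u : G, forall v : G, adj u v ==> (f u != f v)].

Definition colorable (G : sgraph) (k : nat) : bool :=
  [exists f : {ffun G -> 'I_k}, proper_coloring f].

Lemma ex_colorable (G : sgraph) : exists k, colorable G k.
Proof.
exists #|G|; apply/existsP; exists [ffun u => enum_rank u].
apply/forallP=> u; apply/forallP=> v; apply/implyP=> uv; rewrite !ffunE.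
by apply: contraTneq uv => /enum_rank_inj ->; rewrite adj_irrefl.
Qed.

Definition chromatic_number (G : sgraph) : nat := ex_minn (ex_colorable G).

Section Induced.
Variables (G : sgraph) (A : {set G}).

Definition induced_adj : rel {x : G | x \in A} :=
  fun x y => adj (val x) (val y).

Lemma induced_adj_sym : symmetric induced_adj.
Proof. by move=> x y; apply: adj_sym. Qed.

Lemma induced_adj_irrefl : irreflexive induced_adj.
Proof. by move=> x; apply: adj_irrefl. Qed.

Definition induced : sgraph := SGraph induced_adj_sym induced_adj_irrefl.
End Induced.

Section Complete.
Variable n : nat.

Definition complete_adj : rel 'I_n := fun i j => i != j.

Lemma complete_adj_sym : symmetric complete_adj.
Proof. by move=> i j; apply: (congr1 negb (eq_sym i j)). Qed.

Lemma complete_adj_irrefl : irreflexive complete_adj.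
Proof. by move=> i; apply: (congr1 negb (eqxx i)). Qed.

Definition complete : sgraph := SGraph complete_adj_sym complete_adj_irrefl.
End Complete.

Definition graph_iso (G H : sgraph) : Prop :=
  exists2 f : G -> H, bijective f & {mono f : x y / adj x y}.

Definition component (G : sgraph) (x : G) : {set G} :=
  [set y | connect (@adj G) x y].

(* A weighting is a function on all vertex sets of which only the values on    *)
(* edges matter.                                                               *)
Definition edge_weighting (G : sgraph) (k : nat) (w : {set G} -> nat) : Prop :=
  forall e : {set G}, e \in edges G -> 1 <= w e <= k.

Definition weight_coloring (G : sgraph) (w : {set G} -> nat) (u : G) : nat :=
  \sum_(e in edges G | u \in e) w e.

Definition vertex_coloring_weighting (G : sgraph) (w : {set G} -> nat) : Prop :=
  forall u v : G, adj u v -> weight_coloring w u <> weight_coloring w v.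

(* Main.v *)
(**
  Fix a proper coloring [f] with [k] colors. It suffices to find a spanning
  subgraph [h] with [deg v + deg_h v] congruent to [2 f v] or [2 f v + 1] modulo
  [2 k] at every [v], and to give weight 2 to the edges of [h] and weight 1 to
  the others. In fact any residues [a v] modulo [m] can be prescribed for
  [deg_h v] up to an error of 1 as soon as all degrees are at least [4 m]:
  choosing [lo v] in the right residue class just below [deg v / 2] and
  [hi v = lo v + m], this follows from a theorem of Addario-Berry, Dalal and
  Reed, by which some spanning subgraph has all its degrees in
  [{lo, lo + 1, hi, hi + 1}].

  To prove the latter, choose a target in [{lo, hi}] at each vertex and a
  subgraph exceeding no target by more than 1, with the least total deficit.
  From a deficient vertex [x] explore alternating paths. The slack of 1 in the
  degrees separates the reached vertices into those above their target and the
  others, as otherwise an alternating path can be augmented. Flipping a path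
  from [x] to [v] moves the deficit from [x] to [v]; if [v] has enough neighbors
  on the other side, the edges to some of them can then be toggled so that [v]
  meets its other target instead. When no vertex can be switched in this way,
  counting the edges between the two sides gives a contradiction.
*)
Require Import Defs.
From mathcomp Require Import all_boot all_order.
From mathcomp Require Import zify.

Set Implicit Arguments.
Unset Strict Implicit.
Unset Printing Implicit Defensive.

Import Order.TTheory.

Lemma ltn_sum_at (I : finType) (P : pred I) (i : I) (E1 E2 : I -> nat) :
    P i -> (forall j, P j -> E1 j <= E2 j) -> E1 i < E2 i ->
  \sum_(j | P j) E1 j < \sum_(j | P j) E2 j.
Proof.
move=> Pi leE ltE; rewrite (bigD1 i) //= [ltnRHS](bigD1 i) //= -addSn.
by rewrite leq_add // leq_sum // => j /andP[/leE].
Qed.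

Section FiniteSets.
Variable T : finType.
Implicit Types (u v w : T) (S X : {set T}).

Lemma exists_subset_card X k :
  k <= #|X| -> exists2 S : {set T}, S \subset X & #|S| = k.
Proof.
rewrite -bin_gt0 -cards_draws => /card_gt0P[S].
by rewrite inE => /andP[SX /eqP Sk]; exists S.
Qed.

Lemma card_symdiff S X :
  #|(S :\: X) :|: (X :\: S)| + 2 * #|S :&: X| = #|S| + #|X|.
Proof.
rewrite -(cardsID X S) -(cardsID S X) cardsU [X :&: S]setIC.
rewrite (_ : _ :&: (X :\: S) = set0) ?cards0; first by lia.
by apply/setP => w; rewrite !inE; case: (w \in S); case: (w \in X).
Qed.

Lemma cardsI1 S v : #|S :&: [set v]| = (v \in S).
Proof.
case: (boolP (v \in S)) => vS; last first.
  by rewrite setIC disjoint_setI0 ?cards0 // disjoints1.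
by rewrite (setIidPr _) ?sub1set // cards1.
Qed.

Lemma set2_inj u : injective (fun v => [set u; v]).
Proof.
move=> v w uvw; have /set2P[vu|//] : v \in [set u; w] by rewrite -uvw set22.
have /set2P[wu|//] : w \in [set u; v] by rewrite uvw set22.
by rewrite vu wu.
Qed.

End FiniteSets.

Section Neighbors.
Variable T : finType.
Implicit Types (h : rel T) (u v w : T) (A B S : {set T}).

Definition neighbors h v : {set T} := [set w | h v w].

Definition deg h v : nat := #|neighbors h v|.

Lemma sum_card_neighborsI h A B : symmetric h ->
  \sum_(v in A) #|neighbors h v :&: B| = \sum_(w in B) #|neighbors h w :&: A|.
Proof.
move=> h_sym; have cardE C v : #|neighbors h v :&: C| = \sum_(w in C) h v w.
  rewrite -sum1_card big_mkcond [RHS]big_mkcond; apply: eq_bigr => w _ /=.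
  by rewrite !inE andbC; case: (w \in C); case: (h v w).
under eq_bigr do rewrite cardE; rewrite exchange_big /=.
by apply: eq_bigr => w _; rewrite cardE; apply: eq_bigr => v _; rewrite h_sym.
Qed.

Definition toggle_star v S h : rel T := fun u w =>
  h u w (+) ((u == v) && (w \in S) || (w == v) && (u \in S)).

Lemma toggle_star_sym v S h : symmetric h -> symmetric (toggle_star v S h).
Proof. by move=> h_sym u w; rewrite /toggle_star h_sym orbC. Qed.

Lemma deg_toggle_center h v S : v \notin S ->
  deg (toggle_star v S h) v + 2 * #|neighbors h v :&: S| = deg h v + #|S|.
Proof.
move=> vS; rewrite -card_symdiff; congr (#|pred_of_set _| + _).
apply/setP => w; rewrite !inE /toggle_star eqxx (negbTE vS) andbF orbF.
by case: (h v w); case: (w \in S).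
Qed.

Lemma deg_toggle_leaf h v S u : u != v ->
  deg (toggle_star v S h) u + 2 * (h u v && (u \in S)) = deg h u + (u \in S).
Proof.
move=> uv; case: (boolP (u \in S)) => uS; last first.
  rewrite andbF !addn0; apply: eq_card => w.
  by rewrite !inE /toggle_star (negbTE uv) (negbTE uS) andbF addbF.
have := card_symdiff (neighbors h u) [set v].
rewrite cards1 cardsI1 inE andbT => <-; congr (#|pred_of_set _| + _).
apply/setP => w; rewrite !inE /toggle_star (negbTE uv) uS andbT /=.
by case: (h u w); case: (w == v).
Qed.

Lemma deg_toggle_edge h x y v : symmetric h -> x != y ->
  deg (toggle_star x [set y] h) v + h x y * ((v == x) + (v == y)).*2 =
    deg h v + (v == x) + (v == y).
Proof.
move=> h_sym xy; have [->|vx] := eqVneq v x.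
  have := @deg_toggle_center h x [set y]; rewrite cards1 cardsI1 !inE.
  by rewrite (negbTE xy); lia.
have := deg_toggle_leaf h [set y] vx; rewrite inE h_sym.
by have [->|vy] := eqVneq v y; lia.
Qed.

Definition edges_of h : {set {set T}} :=
  [set [set p.1; p.2] | p in [set p : T * T | h p.1 p.2]].

Lemma incident_edges h u : symmetric h ->
  [set e in edges_of h | u \in e] = [set [set u; v] | v in neighbors h u].
Proof.
move=> h_sym; apply/setP => e; rewrite inE.
apply/andP/imsetP => [[/imsetP[[a b]]]|[v]]; rewrite inE => /= huv ->.
  case/set2P => ->; first by exists b; rewrite ?inE.
  by exists a; [rewrite inE h_sym | rewrite setUC].
by rewrite set21; split=> //; apply/imsetP; exists (u, v); rewrite ?inE.
Qed.

Lemma card_incident_edges h u : symmetric h ->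
  #|[set e in edges_of h | u \in e]| = deg h u.
Proof.
by move=> /incident_edges ->; rewrite card_imset //; apply: set2_inj.
Qed.

End Neighbors.

Section Subgraphs.
Variable G : sgraph.
Implicit Types (h : rel G) (u v w x y : G) (S : {set G}) (p : seq G).

Definition spanning h := symmetric h /\ subrel h (@adj G).

Lemma toggle_star_spanning v S h :
  spanning h -> {in S, forall w, adj v w} -> spanning (toggle_star v S h).
Proof.
move=> [h_sym hG] vS; split; first exact: toggle_star_sym.
move=> u w; rewrite /toggle_star; case: (boolP (h u w)) => [/hG //|_] /=.
by case/orP => /andP[/eqP -> /vS //]; rewrite adj_sym.
Qed.

Definition alternating h (top : pred G) : rel G := fun u w =>
  [&& adj u w, h u w == top u & top w != top u].

(* Each edge of the path is removed or added according to its first vertex,  *)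
(* so the two changes at an inner vertex cancel.                             *)
Lemma flip_alternating_path h (top : pred G) x p (l := last x p) :
    spanning h -> path (alternating h top) x p -> uniq (x :: p) ->
  exists h', [/\ spanning h',
    forall u w, top u = top w -> h' u w = h u w &
    forall v,
      deg h' v + (top x && (v == x)) + (~~ top l && (v == l)) =
      deg h v + (~~ top x && (v == x)) + (top l && (v == l))].
Proof.
rewrite {}/l; elim: p x h => [|y p IHp] x h hG.
  by exists h; split=> // v /=; lia.
move=> /= /andP[/and3P[xy /eqP hxy top_xy] yp] /andP[x_yp uniq_yp].
have xy_neq : x != y by apply: contraNneq x_yp => ->; rewrite mem_head.
pose h1 := toggle_star x [set y] h.
have h1G : spanning h1 by apply: toggle_star_spanning => // w /set1P ->.
have yp1 : path (alternating h1 top) y p.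
  apply: (@sub_in_path _ (predC1 x) _ (alternating h1 top)) yp.
    move=> u w ux wx; rewrite /alternating /h1 /toggle_star.
    by rewrite (negbTE ux) (negbTE wx) addbF.
  by apply/allP => u u_yp /=; apply: contraNneq x_yp => <-.
have [h' [h'G h'h1 h'deg]] := IHp y h1 h1G yp1 uniq_yp.
exists h'; split=> // [u w top_uw|v].
  rewrite h'h1 // /h1 /toggle_star !inE [X in _ (+) X](_ : _ = false) ?addbF //.
  by apply/negP => /orP[] /andP[/eqP ux /eqP wy];
    rewrite -ux -wy top_uw eqxx in top_xy.
have top_y : top y = ~~ top x by move: top_xy; case: (top y); case: (top x).
move: (deg_toggle_edge v hG.1 xy_neq) (h'deg v); rewrite -/h1 top_y hxy.
by clear; case: (top x) => /=; lia.
Qed.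

End Subgraphs.

Section Augmentation.
Variable G : sgraph.
Implicit Types (t : G -> nat) (h : rel G) (u v w x y : G) (S : {set G}).

Definition feasible t h := spanning h /\ forall v, deg h v <= (t v).+1.

Definition deficit t h v := t v - deg h v.

Definition improves t h t' := exists2 h' : rel G,
  feasible t' h' & \sum_v deficit t' h' v < \sum_v deficit t h v.

Variables (t : G -> nat) (h : rel G) (x : G).
Hypothesis th_feasible : feasible t h.
Hypothesis x_deficient : deg h x < t x.

Definition exceeds v := t v < deg h v.

Definition reached v := connect (alternating h exceeds) x v.

Definition reached_below : {set G} := [set v | reached v && ~~ exceeds v].

Definition reached_above : {set G} := [set v | reached v && exceeds v].

Let x_below : exceeds x = false.
Proof. by apply/negbTE; rewrite -leqNgt ltnW. Qed.

Lemma flip_to v : reached v -> exists h1,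
  [/\ spanning h1,
      forall u w, exceeds u = exceeds w -> h1 u w = h u w,
      forall u, u != v -> deg h1 u = deg h u + (u == x) &
      deg h1 v + ~~ exceeds v = deg h v + (v == x) + exceeds v].
Proof.
move=> /connectP[p0 xp0 def_v]; have [hG _] := th_feasible.
case/shortenP: xp0 def_v => p xp p_uniq _ def_v.
have [h1 [h1G h1h h1deg]] := flip_alternating_path hG xp p_uniq.
rewrite -def_v x_below /= in h1deg; exists h1; split=> // [u uv|].
  by have := h1deg u; rewrite (negbTE uv); lia.
by have := h1deg v; rewrite eqxx; lia.
Qed.

(* The slack of 1 lets each vertex of [S] absorb the change of its degree,   *)
(* even at [x], whose degree may have been raised before.                    *)
Lemma improves_toggle_star v S h1 t' (d := deg (toggle_star v S h1) v) :
    spanning h1 -> (forall u, u != v -> deg h1 u = deg h u + (u == x)) ->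
    {in S, forall w, adj v w /\ h1 v w = exceeds w} ->
    (forall u, u != v -> t' u = t u) ->
    d <= (t' v).+1 -> t' v - d + (v == x) <= deficit t h v ->
  improves t h t'.
Proof.
rewrite {}/d => h1G h1deg vS t't d_le d_def; set h2 := toggle_star v S h1.
have deg_u u : u != v -> deg h2 u <= (t u).+1 /\
    t u - deg h2 u + (u == x) <= deficit t h u.
  move=> uv; have := deg_toggle_leaf h1 S uv; rewrite h1deg // -/h2.
  have : u \in S -> h1 u v = exceeds u by rewrite h1G.1 => /vS[].
  have : u == x -> deg h u < t u by move=> /eqP ->.
  by have := th_feasible.2 u; rewrite /deficit /exceeds; lia.
have deficit_le u : deficit t' h2 u + (u == x) <= deficit t h u.
  rewrite {1}/deficit; have [->|uv] := eqVneq u v; first exact: d_def.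
  by rewrite t't //; have [] := deg_u u uv.
exists h2; first split.
- by apply: toggle_star_spanning => // w /vS[].
- move=> u; have [->|uv] := eqVneq u v; first exact: d_le.
  by rewrite t't //; have [] := deg_u u uv.
apply: (ltn_sum_at (i := x)) => // [u _|].
  by apply: leq_trans (deficit_le u); apply: leq_addr.
by have := deficit_le x; rewrite eqxx addn1.
Qed.

Lemma improves_same_side u w :
    reached u -> adj u w -> h u w = exceeds u -> exceeds w = exceeds u ->
  improves t h t.
Proof.
move=> ru uw huw wu; have [h1 [h1G h1h h1deg h1u]] := flip_to ru.
have h1uw : h1 u w = exceeds u by rewrite h1h ?wu.
have u_notin : u \notin [set w].
  by apply: contraTN uw => /set1P ->; rewrite adj_irrefl.
have h2u := deg_toggle_center h1 u_notin.
rewrite cards1 cardsI1 inE h1uw in h2u.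
have u_def : u == x -> deg h u < t u by move=> /eqP ->.
apply: (improves_toggle_star (S := [set w]) h1G h1deg) => //.
- by move=> _ /set1P ->; rewrite h1uw wu.
- by have := th_feasible.2 u; move: h2u h1u; lia.
by move: h2u h1u u_def; rewrite /deficit; lia.
Qed.

Lemma improves_lower v k :
    v \in reached_below -> k < t v ->
    #|neighbors (@adj G) v :\: reached_above| <= k.+1 ->
  improves t h [eta t with v |-> k].
Proof.
rewrite inE => /andP[rv v_below] kt few.
have [h1 [h1G _ h1deg h1v]] := flip_to rv.
have cardX : deg h1 v - k.+1 <= #|neighbors h1 v :&: reached_above|.
  rewrite leq_subLR -[leqLHS](cardsID reached_above) addnC leq_add2r.
  apply: leq_trans few; apply/subset_leq_card/setSD/subsetP => w.
  by rewrite !inE => /h1G.2.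
have [S /subsetP SX cardS] := exists_subset_card cardX.
have S_h1 w : w \in S -> h1 v w /\ exceeds w.
  by move=> /SX; rewrite !inE => /andP[-> /andP[]].
have v_notin : v \notin S by apply: contraNN v_below => /S_h1[].
have S_sub : S \subset neighbors h1 v.
  by apply/subsetP => w /S_h1[]; rewrite inE.
have h2v := deg_toggle_center h1 v_notin; rewrite (setIidPr S_sub) cardS in h2v.
have v_def : v == x -> deg h v < t v by move=> /eqP ->.
apply: (improves_toggle_star (S := S) h1G h1deg) => //=.
- by move=> w /S_h1[hvw ->]; rewrite hvw (h1G.2 _ _ hvw).
- by move=> u /negbTE ->.
- by rewrite eqxx; move: h2v; lia.
move: h2v h1v v_def kt v_below; rewrite eqxx /deficit /exceeds.
by lia.
Qed.

Lemma improves_raise v k :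
    v \in reached_above -> t v < k ->
    k <= #|neighbors (@adj G) v :&: reached_below| ->
  improves t h [eta t with v |-> k].
Proof.
rewrite inE => /andP[rv v_above] tk many.
have [h1 [h1G _ h1deg h1v]] := flip_to rv.
pose X := (neighbors (@adj G) v :&: reached_below) :\: neighbors h1 v.
have cardX : k - deg h1 v <= #|X|.
  rewrite leq_subLR; apply: leq_trans many _.
  by rewrite -(cardsID (neighbors h1 v)) leq_add2r subset_leq_card ?subsetIr.
have [S /subsetP SX cardS] := exists_subset_card cardX.
have S_h1 w : w \in S -> [/\ adj v w, h1 v w = false & exceeds w = false].
  move=> /SX; rewrite !inE => /and3P[/negbTE -> ->].
  by case/andP=> _ /negbTE ->.
have v_notin : v \notin S by apply: contraTN v_above => /S_h1[_ _ ->].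
have S_disj : neighbors h1 v :&: S = set0.
  apply/setP => w; rewrite !inE.
  by case: (boolP (w \in S)) => [/S_h1[_ ->]|]; rewrite ?andbF.
have h2v := deg_toggle_center h1 v_notin; rewrite S_disj cards0 cardS in h2v.
have vx : v != x by apply: contraTneq v_above => ->; rewrite x_below.
have deg_v := th_feasible.2 v.
apply: (improves_toggle_star (S := S) h1G h1deg) => //=.
- by move=> w /S_h1[-> -> ->].
- by move=> u /negbTE ->.
- by move: h1v h2v deg_v; rewrite eqxx; lia.
by move: h1v h2v v_above vx; rewrite eqxx /exceeds; lia.
Qed.

Section Obstruction.
Hypothesis alternates : forall u w,
  reached u -> adj u w -> h u w = exceeds u -> exceeds w != exceeds u.

Lemma reached_alternating u w :
  reached u -> adj u w -> h u w = exceeds u -> reached w.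
Proof.
move=> ru uw huw; apply: (connect_trans ru (connect1 _)).
by rewrite /alternating uw huw eqxx alternates.
Qed.

Lemma neighborsD_reached_above v : v \in reached_below ->
  neighbors (@adj G) v :\: reached_above = neighbors h v :\: reached_above.
Proof.
rewrite inE => /andP[rv /negbTE v_below].
apply/setP => w; rewrite !in_setD; apply/andb_id2l; rewrite !inE => w_notin.
apply/idP/idP => [vw|/(th_feasible.1.2)//].
apply: contraNT w_notin => /negbTE hvw; rewrite -v_below in hvw.
have := alternates rv vw hvw.
by rewrite (reached_alternating rv vw hvw) v_below eqbF_neg negbK.
Qed.

Lemma neighbors_sub_reached_below v :
  v \in reached_above -> neighbors h v \subset reached_below.
Proof.
rewrite inE => /andP[rv v_above]; apply/subsetP => w; rewrite !inE => hvw.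
have vw := th_feasible.1.2 _ _ hvw; rewrite /is_true -v_above in hvw.
have := alternates rv vw hvw.
by rewrite (reached_alternating rv vw hvw) v_above eqb_id.
Qed.

(* Otherwise the degrees above their targets show that [h] contains at least *)
(* half of the edges between the two sets, while the total deficit of the    *)
(* vertices below shows that it contains less than half of them.             *)
Lemma exists_unbalanced :
  (exists2 v, v \in reached_below &
     2 * degree v < 2 * t v + #|neighbors (@adj G) v :&: reached_above|) \/
  (exists2 v, v \in reached_above &
     2 * (t v).+1 < #|neighbors (@adj G) v :&: reached_below|).
Proof.
set A := reached_below; set B := reached_above.
have [/exists_inP|/exists_inPn balanced_below] := boolP [exists v in A,
  2 * degree v < 2 * t v + #|neighbors (@adj G) v :&: B|]; first by left.
have [/exists_inP|/exists_inPn balanced_above] := boolP [exists v in B,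
  2 * (t v).+1 < #|neighbors (@adj G) v :&: A|]; first by right.
exfalso; pose cut (g : rel G) := \sum_(v in A) #|neighbors g v :&: B|.
have complement_below :
    \sum_(v in A) deg h v + cut (@adj G) = \sum_(v in A) degree v + cut h.
  rewrite -!big_split /=; apply: eq_bigr => v vA.
  rewrite -[degree v]/#|neighbors (@adj G) v| /deg.
  rewrite -(cardsID B (neighbors h v)) -(cardsID B (neighbors (@adj G) v)).
  by rewrite neighborsD_reached_above // -/B; lia.
have half_le : cut (@adj G) <= 2 * cut h.
  have [[h_sym _] _] := th_feasible.
  rewrite /cut (sum_card_neighborsI A B (@adj_sym G)).
  rewrite (sum_card_neighborsI A B h_sym) big_distrr leq_sum //= => v vB.
  have := balanced_above v vB; rewrite -leqNgt => /leq_trans -> //.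
  rewrite leq_mul2l (setIidPl (neighbors_sub_reached_below vB)) /=.
  by move: vB; rewrite inE => /andP[].
have balanced_sum :
    2 * \sum_(v in A) t v + cut (@adj G) <= 2 * \sum_(v in A) degree v.
  rewrite !big_distrr /= -big_split leq_sum // => v /balanced_below.
  by rewrite -leqNgt.
have deficient : \sum_(v in A) deg h v < \sum_(v in A) t v.
  apply: (ltn_sum_at (i := x)) => // [|v]; rewrite inE.
    by rewrite x_below /reached connect0.
  by rewrite -leqNgt => /andP[].
by move: complement_below half_le balanced_sum deficient; clear; lia.
Qed.

End Obstruction.
End Augmentation.

Section DegreeConstrained.
Variables (G : sgraph) (lo hi : G -> nat).
Implicit Types (t : G -> nat) (h : rel G) (u v w x : G).

Definition admissible t := forall v, t v \in [:: lo v; hi v].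

Hypothesis lo_half : forall v, 2 * lo v <= degree v.
Hypothesis hi_half : forall v, degree v <= 2 * (hi v).+1.
Hypothesis hi_degree : forall v, 2 * hi v <= degree v + lo v + 2.
Hypothesis hi_lo : forall v, hi v <= 2 * lo v + 3.

Lemma deficient_improvable t h x :
    admissible t -> feasible t h -> deg h x < t x ->
  exists2 t', admissible t' & improves t h t'.
Proof.
move=> t_adm th_feasible x_def.
have retarget v k : k \in [:: lo v; hi v] -> admissible [eta t with v |-> k].
  by move=> k_lohi u /=; case: eqP => [->|_]; last exact: t_adm.
have [/existsP[u /existsP[w /and4P[ru uw /eqP huw /eqP wu]]]|no_same_side] :=
  boolP [exists u, exists w, [&& reached t h x u, adj u w,
           h u w == exceeds t h u & exceeds t h w == exceeds t h u]].
  by exists t => //; apply: improves_same_side ru uw huw wu.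
have alternates u w : reached t h x u -> adj u w -> h u w = exceeds t h u ->
    exceeds t h w != exceeds t h u.
  move=> ru uw huw; apply: contraNN no_same_side => wu.
  apply/existsP; exists u; apply/existsP.
  by exists w; rewrite ru uw huw eqxx.
have degreeE v S : #|neighbors (@adj G) v :&: S| +
  #|neighbors (@adj G) v :\: S| = degree v by rewrite cardsID.
have [[v v_below unbalanced]|[v v_above unbalanced]] :=
  exists_unbalanced th_feasible x_def alternates.
  exists [eta t with v |-> lo v]; first by apply: retarget; rewrite !inE eqxx.
  have := degreeE v (reached_above t h x).
  have := t_adm v; rewrite !inE => tv degv.
  by apply: improves_lower => //; have := lo_half v; have := hi_degree v; lia.
exists [eta t with v |-> hi v].
  by apply: retarget; rewrite !inE eqxx orbT.
have := degreeE v (reached_below t h x).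
have := t_adm v; rewrite !inE => tv degv.
by apply: improves_raise => //; have := hi_half v; have := hi_lo v; lia.
Qed.

Theorem degree_constrained_subgraph : exists2 h, spanning h &
  forall v, deg h v \in [:: lo v; (lo v).+1; hi v; (hi v).+1].
Proof.
suff from_feasible n t h : admissible t -> feasible t h ->
    \sum_v deficit t h v < n -> exists2 h', spanning h' &
    forall v, deg h' v \in [:: lo v; (lo v).+1; hi v; (hi v).+1].
  apply: (from_feasible _ lo [rel u v : G | false] _ _ (ltnSn _)).
    by move=> v; rewrite mem_head.
  by split=> // v; rewrite [deg _ _]eq_card0 // => w; rewrite inE.
elim: n t h => // n IHn t h t_adm th_feasible; rewrite ltnS => le_n.
have [x x_def|full] := pickP (fun x => deg h x < t x).
  have [t' t'_adm [h' t'h'_feasible lt_deficit]] :=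
    deficient_improvable t_adm th_feasible x_def.
  exact: IHn t'_adm t'h'_feasible (leq_trans lt_deficit le_n).
case: th_feasible => hG h_le; exists h => // v.
by move: (t_adm v) (full v) (h_le v); rewrite !inE; lia.
Qed.

End DegreeConstrained.

Lemma exists_modn_window m a n :
  m <= n.+1 -> 0 < m -> exists2 l, l <= n < l + m & l = a %[mod m].
Proof.
move=> le_m m_gt0; pose r := (n + a * m.-1) %% m.
have r_lt : r < m by rewrite ltn_mod.
exists (n - r); first by lia.
apply/eqP; rewrite -(eqn_modDr r) subnK; last by lia.
by rewrite /r modnDmr addnCA -mulnS prednK // addnC modnMDl.
Qed.

Theorem spanning_subgraph_mod (G : sgraph) (m : nat) (a : G -> nat) :
    (forall v : G, 0 < 4 * m <= degree v) ->
  exists2 h, spanning h &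
    forall v : G, exists b : bool, deg h v = a v + b %[mod m].
Proof.
move=> m_degree.
have /fin_all_exists2[lo lo_window lo_mod] (v : G) : exists2 l,
    l <= (degree v)./2 < l + m & l = a v %[mod m].
  by have m_deg := m_degree v; apply: exists_modn_window; lia.
have [||||h hG h_deg] := @degree_constrained_subgraph G lo (fun v => lo v + m).
1-4: by move=> v; have := lo_window v; have := m_degree v; lia.
exists h => // v.
have [b [c ->]] : exists b c : bool, deg h v = c * m + (lo v + b).
  have := h_deg v; rewrite !inE => /or4P[] /eqP ->;
    [exists false, false | exists true, false
    | exists false, true | exists true, true]; lia.
by exists b; rewrite modnMDl -modnDml lo_mod modnDml.
Qed.

Section Weighting.
Variables (G : sgraph) (h : rel G).
Hypothesis hG : spanning h.

Definition subgraph_weight (e : {set G}) : nat := 1 + (e \in edges_of h).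

Lemma weight_coloring_subgraph u :
  weight_coloring subgraph_weight u = degree u + deg h u.
Proof.
rewrite -(card_incident_edges u hG.1).
rewrite -[degree u](card_incident_edges u (@adj_sym G)).
have /subsetP edges_sub : edges_of h \subset edges G.
  by apply/imsetS/subsetP => p; rewrite !inE => /hG.2.
rewrite /weight_coloring big_split /= sum1dep_card; congr (_ + _).
rewrite -sum1dep_card big_mkcond [RHS]big_mkcond /=; apply: eq_bigr => e _.
by case: (boolP (e \in edges_of h)) => [/edges_sub ->|_] //; case: ifP.
Qed.

End Weighting.

Lemma exists_chromatic_coloring (G : sgraph) :
  exists f : G -> 'I_(chromatic_number G), proper_coloring f.
Proof.
rewrite /chromatic_number; case: ex_minnP => k /existsP[f f_proper] _.
by exists f.
Qed.

Lemma min_degree_le (G : sgraph) (v : G) : min_degree G <= degree v.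
Proof. by rewrite /min_degree -minEnat -leEnat bigmin_le. Qed.

Lemma vertex_coloring_weighting_of_proper_coloring (G : sgraph) (k : nat)
    (f : G -> 'I_k) :
    proper_coloring f -> (forall v : G, 8 * k <= degree v) ->
  exists w : {set G} -> nat, edge_weighting 2 w /\ vertex_coloring_weighting w.
Proof.
move=> f_proper k_degree; pose m := 2 * k.
have [v|h hG h_deg] := @spanning_subgraph_mod G m
    (fun v => 2 * f v + degree v * m.-1).
  by have := k_degree v; have := ltn_ord (f v); lia.
exists (subgraph_weight h); split=> [e _|u v uv c_uv].
  by rewrite /subgraph_weight; case: (e \in _).
have fE v' : f v' = (weight_coloring (subgraph_weight h) v' %% m)./2 :> nat.
  have f_lt := ltn_ord (f v'); have m_gt0 : 0 < m by lia.
  have [b h_mod] := h_deg v'; rewrite weight_coloring_subgraph //.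
  rewrite -modnDmr h_mod modnDmr.
  have -> : degree v' + (2 * f v' + degree v' * m.-1 + b) =
            degree v' * m + (b + (f v').*2).
    by rewrite -[in RHS](prednK m_gt0); lia.
  by rewrite modnMDl modn_small ?half_bit_double //; case: b {h_mod}; lia.
move/forallP/(_ u)/forallP/(_ v): f_proper; rewrite uv /= => /eqP; apply.
by apply: val_inj; rewrite /= !fE c_uv.
Qed.

Theorem theorem2p5 (G : sgraph)
  (noK2 : forall x : G, ~ graph_iso (induced (component x)) (complete 2))
  (hdeg : 8 * chromatic_number G <= min_degree G) :
  exists w : {set G} -> nat,
    edge_weighting 2 w /\ vertex_coloring_weighting w.
Proof.
have [f f_proper] := exists_chromatic_coloring G.
apply: vertex_coloring_weighting_of_proper_coloring f_proper _ => v.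
exact: leq_trans hdeg (min_degree_le v).
Qed.
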